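(* Let $F,f,h_1,\dots,h_p\colon\mathbb R^n\times\mathbb R^m\to\mathbb R$ be continuously differentiable, $X\subset\mathbb R^n$ closed, $I=\{1,\dots,\ell\}$, $J=\{\ell+1,\dots,p\}$, $\Gamma(x):=\{y\mid h_i(x,y)\le0\ (i\in I),\ h_i(x,y)=0\ (i\in J)\}$, $\varphi(x):=\inf\{f(x,y)\mid y\in\Gamma(x)\}$, $S(x):=\operatorname{argmin}\{f(x,y)\mid y\in\Gamma(x)\}$, $h_0(x,y):=f(x,y)-\varphi(x)$, and $\varphi_p(x):=\sup\{F(x,y)\mid y\in S(x)\}$. Assume (A1'): for each $x$, $f(x,\cdot)$ and $h_i(x,\cdot)$, $i\in I$, are convex and $h_i(x,\cdot)$, $i\in J$, are affine. Assume $X\subset\operatorname{dom}\Gamma$, that $\Gamma$ is locally bounded at each point of $X$, that RCPLD$_S$ with respect to $\operatorname{dom}\Gamma$ holds at each point of $\operatorname{gph}S\cap(X\times\mathbb R^m)$, and that $X$ is nonempty and compact. Then there exists a pessimistic solution of the bilevel problem, i.e., a global minimizer of $\varphi_p$ over $X$.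
   Context: $\operatorname{dom}\Gamma:=\{x\mid\Gamma(x)\neq\emptyset\}$; $\inf\emptyset=+\infty$. $\Gamma$ is locally bounded at $\bar x$ if there are a bounded $B$ and a neighborhood $V$ of $\bar x$ with $\Gamma(x)\subset B$ for $x\in V$. A pair of finite families $((a^i)_{i\in I_1},(b^i)_{i\in I_2})$ is positive-linearly dependent if there are $\alpha_i\ge0$, $\beta_i$, not all zero, with $\sum\alpha_ia^i+\sum\beta_ib^i=0$. For $(\bar x,\bar y)\in\operatorname{gph}S$ let $I(\bar x,\bar y):=\{i\in I\mid h_i(\bar x,\bar y)=0\}$ and $\nabla_yh_0:=\nabla_yf$. RCPLD$_S$ holds at $(\bar x,\bar y)$ with respect to $\Omega$ if there are a neighborhood $U$ of $(\bar x,\bar y)$ and $\mathcal S\subset J$ such that: (i) $\{\nabla_yh_i(\bar x,\bar y)\mid i\in\mathcal S\}$ is a basis of the span of $\{\nabla_yh_i(\bar x,\bar y)\mid i\in J\}$; (ii) $(\nabla_yh_i(x,y))_{i\in J}$ has constant rank on $U\cap(\Omega\times\mathbb R^m)$; (iii) for each $K\subset\{0\}\cup I(\bar x,\bar y)$ with $((\nabla_yh_i(\bar x,\bar y))_{i\in K},(\nabla_yh_i(\bar x,\bar y))_{i\in\mathcal S})$ positive-linearly dependent, $(\nabla_yh_i(x,y))_{i\in K\cup\mathcal S}$ is linearly dependent for each $(x,y)\in U\cap(\Omega\times\mathbb R^m)$. *)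

(* Defs.v *)
From mathcomp Require Import all_boot all_order all_algebra.
From mathcomp Require Import all_classical all_reals all_analysis.
Import Order.TTheory GRing.Theory Num.Theory.
Import numFieldNormedType.Exports.

Set Implicit Arguments.
Unset Strict Implicit.
Unset Printing Implicit Defensive.

Local Open Scope classical_set_scope.
Local Open Scope ring_scope.

Section BilevelDefs.
Variables (R : realType) (n m : nat).

Notation pt := ('rV[R]_n * 'rV[R]_m)%type.

Definition C1 (g : pt -> R) : Prop :=
  (forall z : pt, differentiable g z) /\
  (forall v : pt, continuous (fun z : pt => 'D_v g z)).

Definition grad_y (g : pt -> R) (z : pt) : 'rV[R]_m :=
  \row_(j < m) 'D_((0 : 'rV[R]_n), (delta_mx 0 j : 'rV[R]_m)) g z.

Definition convex_in_y (g : pt -> R) : Prop :=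
  forall (x : 'rV[R]_n) (y1 y2 : 'rV[R]_m) (t : R), 0 <= t <= 1 ->
    g (x, t *: y1 + (1 - t) *: y2) <= t * g (x, y1) + (1 - t) * g (x, y2).

Definition affine_in_y (g : pt -> R) : Prop :=
  forall (x : 'rV[R]_n) (y1 y2 : 'rV[R]_m) (t : R),
    g (x, t *: y1 + (1 - t) *: y2) = t * g (x, y1) + (1 - t) * g (x, y2).

Variable p : nat.
(* constraints h_1..h_p are indexed by 'I_p (0-based): index i stands for
   h_(i+1); I = {i | i < l}, J = {i | l <= i}. *)

Definition Gamma (h : 'I_p -> pt -> R) (l : nat) (x : 'rV[R]_n) : set 'rV[R]_m :=
  [set y | (forall i : 'I_p, (i < l)%N -> h i (x, y) <= 0) /\
           (forall i : 'I_p, (l <= i)%N -> h i (x, y) = 0)].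

Definition domGamma (h : 'I_p -> pt -> R) (l : nat) : set 'rV[R]_n :=
  [set x | exists y, Gamma h l x y].

Definition Sol (f : pt -> R) (h : 'I_p -> pt -> R) (l : nat) (x : 'rV[R]_n)
  : set 'rV[R]_m :=
  [set y | Gamma h l x y /\ forall y', Gamma h l x y' -> f (x, y) <= f (x, y')].

(* phi_p(x) = sup { F(x,y) | y in S(x) }  (extended real, sup of empty = -oo) *)
Definition phi_p (F f : pt -> R) (h : 'I_p -> pt -> R) (l : nat)
  (x : 'rV[R]_n) : \bar R :=
  ereal_sup [set (F (x, y))%:E | y in Sol f h l x].

Definition locally_bounded (G : 'rV[R]_n -> set 'rV[R]_m) (xb : 'rV[R]_n) : Prop :=
  exists (B : set 'rV[R]_m) (V : set 'rV[R]_n),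
    (exists M : R, forall y, B y -> `|y| <= M) /\ nbhs xb V /\
    (forall x, V x -> G x `<=` B).

(* gradient family: index None is h_0 (grad_y h_0 := grad_y f),
   Some i is h_(i+1) *)
Definition gradfam (f : pt -> R) (h : 'I_p -> pt -> R) (z : pt)
  (i : option 'I_p) : 'rV[R]_m :=
  match i with None => grad_y f z | Some j => grad_y (h j) z end.

Definition Jset (l : nat) : {set option 'I_p} :=
  [set i : option 'I_p | if i is Some j then (l <= j)%N else false].

Definition Iact (h : 'I_p -> pt -> R) (l : nat) (z : pt) : {set option 'I_p} :=
  [set i : option 'I_p | if i is Some j then (j < l)%N && (h j z == 0) else false].

Definition linDep (G : option 'I_p -> 'rV[R]_m) (A : {set option 'I_p}) : Prop :=
  exists c : option 'I_p -> R,
    (exists i, i \in A /\ c i != 0) /\ \sum_(i in A) c i *: G i = 0.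

Definition posLinDep (G : option 'I_p -> 'rV[R]_m) (K S : {set option 'I_p}) : Prop :=
  exists a b : option 'I_p -> R,
    (forall i, i \in K -> 0 <= a i) /\
    (exists i, (i \in K /\ a i != 0) \/ (i \in S /\ b i != 0)) /\
    \sum_(i in K) a i *: G i + \sum_(i in S) b i *: G i = 0.

Definition basis_of_span (G : option 'I_p -> 'rV[R]_m) (S A : {set option 'I_p}) : Prop :=
  S \subset A /\ ~ linDep G S /\
  (forall j, j \in A -> exists c : option 'I_p -> R, G j = \sum_(i in S) c i *: G i).

Definition rankJ (h : 'I_p -> pt -> R) (l : nat) (z : pt) : nat :=
  \rank (\matrix_(i < p) (if (l <= i)%N then grad_y (h i) z else 0)).

Definition RCPLD_S (f : pt -> R) (h : 'I_p -> pt -> R) (l : nat)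
  (Omega : set 'rV[R]_n) (xb : 'rV[R]_n) (yb : 'rV[R]_m) : Prop :=
  exists (U : set pt) (S : {set option 'I_p}),
    nbhs (xb, yb) U /\ S \subset Jset l /\
    basis_of_span (gradfam f h (xb, yb)) S (Jset l) /\
    (forall z1 z2 : pt, U z1 -> Omega z1.1 -> U z2 -> Omega z2.1 ->
       rankJ h l z1 = rankJ h l z2) /\
    (forall K : {set option 'I_p},
       K \subset None |: Iact h l (xb, yb) ->
       posLinDep (gradfam f h (xb, yb)) K S ->
       forall z : pt, U z -> Omega z.1 -> linDep (gradfam f h z) (K :|: S)).

End BilevelDefs.

(* Main.v *)
(** Inner semicontinuity of [S] relative to [X] makes [phi_p] lower
    semicontinuous on [X], and a lower semicontinuous function attains its
    minimum on a compact set. To get inner semicontinuity at [(xb, yb)], suppose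
    that [S x] misses a small sup-norm ball [B] around [yb], and minimize over
    [B] the quadratic penalty of the constraints defining [S x]. At the
    minimizer the penalty gradient does not vanish, by convexity. Caratheodory
    reduction and the constant rank condition rewrite it with linearly
    independent gradients; RCPLD then bounds the multipliers by a constant times
    its norm. Testing against [yb], where every constraint is violated by at
    most some [delta] tending to [0] as [x] tends to [xb], bounds the radius of
    [B] by a multiple of [delta], a contradiction. Only the lower
    semicontinuity of [phi] enters, through [f (x, yb) - phi x <= delta]. *)

Require Import Defs.
From mathcomp Require Import all_boot all_order all_algebra.
From mathcomp Require Import all_classical all_reals all_analysis.
From mathcomp Require Import ring lra.
Import Order.TTheory GRing.Theory Num.Theory.
Import numFieldNormedType.Exports.
Local Open Scope classical_set_scope.
Local Open Scope ring_scope.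

Set Implicit Arguments.
Unset Strict Implicit.
Unset Printing Implicit Defensive.

(** * Finite sums and the duality of the sup norm with the dot product *)

Lemma big_set_support (V : nmodType) (T : finType) (A B : {set T}) (F : T -> V) :
  B \subset A -> (forall i, i \in A -> i \notin B -> F i = 0) ->
  \sum_(i in A) F i = \sum_(i in B) F i.
Proof.
move=> /fintype.subsetP sBA F0; rewrite big_mkcond [RHS]big_mkcond /=.
apply: eq_bigr => i _; have [iB|iB] := boolP (i \in B); first by rewrite sBA.
by case: ifPn => // iA; exact: F0.
Qed.

Section dot_product.
Variables (R : realType) (m : nat).
Implicit Types u v w : 'rV[R]_m.

Definition dot u v : R := \sum_(j < m) u 0 j * v 0 j.

Lemma dot_suml (T : finType) (A : pred T) (c : T -> R) (G : T -> 'rV[R]_m) v :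
  dot (\sum_(i | A i) c i *: G i) v = \sum_(i | A i) c i * dot (G i) v.
Proof.
rewrite /dot; under eq_bigr do rewrite summxE mulr_suml.
rewrite exchange_big; apply: eq_bigr => i _; rewrite mulr_sumr.
by apply: eq_bigr => j _; rewrite mxE mulrA.
Qed.

Lemma dotNl u v : dot (- u) v = - dot u v.
Proof. by rewrite /dot -sumrN; apply: eq_bigr => j _; rewrite mxE mulNr. Qed.

Lemma dotNr u v : dot u (- v) = - dot u v.
Proof. by rewrite /dot -sumrN; apply: eq_bigr => j _; rewrite mxE mulrN. Qed.

Lemma dotBr u v w : dot u (v - w) = dot u v - dot u w.
Proof.
by rewrite /dot -sumrB; apply: eq_bigr => j _; rewrite !mxE mulrBr.
Qed.

Lemma rV_norm_le v (r : R) : 0 <= r -> (forall j, `|v 0 j| <= r) -> `|v| <= r.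
Proof.
move=> r0 vr; rewrite -[`|v|]/(mx_norm v) mx_normrE; apply: bigmax_le => // -[i j] _ /=.
by rewrite (ord1 i).
Qed.

(* The l^1 norm is the dual of the sup norm, and it dominates the latter. *)
Lemma dot_norming u (r : R) : 0 <= r ->
  exists2 v, `|v| <= r & r * `|u| <= dot u v.
Proof.
move=> r0; exists (\row_j (r * Num.sg (u 0 j))).
  apply: rV_norm_le => // j; rewrite mxE normrM normr_sg (ger0_norm r0).
  by case: (u 0 j != 0); rewrite ?mulr1 ?mulr0.
have -> : dot u (\row_j (r * Num.sg (u 0 j))) = r * \sum_j `|u 0 j|.
  rewrite /dot mulr_sumr; apply: eq_bigr => j _.
  by rewrite mxE mulrCA normrEsg [u 0 j * _]mulrC.
apply: ler_wpM2l => //; apply: rV_norm_le => [|j]; first exact: sumr_ge0.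
by rewrite (bigD1 j) //= lerDl sumr_ge0.
Qed.

End dot_product.

(** * Caratheodory reduction of conic combinations *)

Section dependence.
Variables (R : realType) (m p : nat).
Local Notation T := (option 'I_p).
Implicit Types (G : T -> 'rV[R]_m) (A K S : {set T}).

(** While the family over [A :|: S] is dependent, any relation must involve [A], because [S] is
    free; subtracting a suitable multiple of it removes one index of [A]. Coefficients on [S] may
    take any sign, so [S] is kept whole. *)
Lemma conic_caratheodory G A S (c : T -> R) :
  ~ linDep G S -> (forall i, i \in A -> 0 <= c i) ->
  exists (K : {set T}) (d : T -> R),
    [/\ K \subset A, forall i, i \in K -> 0 <= d i, ~ linDep G (K :|: S) &
        \sum_(i in K :|: S) d i *: G i = \sum_(i in A :|: S) c i *: G i].
Proof.
move=> indS; have [k] := ubnP #|A|; elim: k A c => // k IH A c ltAk c0.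
have [[e0 [nz0 sum0]]|ind] := pselect (linDep G (A :|: S)); last first.
  by exists A, c; split.
have [e [[i0 [i0A ei0]] sume]] : exists e : T -> R,
    (exists i, i \in A /\ 0 < e i) /\ \sum_(i in A :|: S) e i *: G i = 0.
  have [/existsP[i /andP[iA e0i]]|/existsPn no] :=
      boolP [exists i, (i \in A) && (e0 i != 0)].
    have [ei|ei|ei] := ltgtP (e0 i) 0; last by rewrite ei eqxx in e0i.
      exists (fun j => - e0 j); split; first by exists i; rewrite oppr_gt0.
      by under eq_bigr do rewrite scaleNr; rewrite sumrN sum0 oppr0.
    by exists e0; split => //; exists i.
  case: indS; exists e0.
  have eA i : i \in A -> e0 i = 0.
    by move=> iA; have := no i; rewrite iA /= negbK => /eqP.
  split.
    have [i [iAS ei]] := nz0; exists i; split => //.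
    by move: iAS; rewrite inE => /orP[/eA ei0|//]; rewrite ei0 eqxx in ei.
  apply: etrans sum0; symmetry; apply: big_set_support; first exact: finset.subsetUr.
  move=> i; rewrite inE => /orP[/eA -> _|-> //]; exact: scale0r.
have Pi0 : (i0 \in A) && (0 < e i0) by rewrite i0A.
(* Ratio test: minimizing [c i / e i] over the indices of [A] with [0 < e i] makes [t] the largest
   step that keeps [d] nonnegative on [A]. *)
case: (@Order.TotalTheory.arg_minP _ R T i0 (fun i => (i \in A) && (0 < e i))
  (fun i => c i / e i) Pi0) => i1 /andP[i1A e1] min1.
pose t := c i1 / e i1; pose d i := c i - t * e i.
have t0 : 0 <= t by rewrite divr_ge0 ?c0 // ltW.
have d1 : d i1 = 0 by rewrite /d /t divfK ?subrr // gt_eqF.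
have d0 i : i \in A -> 0 <= d i.
  move=> iA; rewrite subr_ge0; have [ei|ei] := ltP 0 (e i).
    by rewrite -ler_pdivlMr //; apply: min1; rewrite iA.
  by apply: le_trans (c0 i iA); rewrite mulr_ge0_le0.
have sumd : \sum_(i in (A :\ i1) :|: S) d i *: G i =
            \sum_(i in A :|: S) c i *: G i.
  transitivity (\sum_(i in A :|: S) d i *: G i).
    symmetry; apply: big_set_support; first by rewrite finset.setSU // finset.subD1set.
    move=> i; rewrite !inE => /orP[->|-> ]; rewrite ?orbT // andbT negb_or negbK.
    by case/andP => /eqP-> _; rewrite d1 scale0r.
  under eq_bigr do rewrite scalerBl -scalerA.
  by rewrite sumrB -scaler_sumr sume scaler0 subr0.
have [||K [d' [sK dK iK sumK]]] := IH (A :\ i1) d.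
- by move: ltAk; rewrite (cardsD1 i1) i1A.
- by move=> i; rewrite !inE => /andP[_ /d0].
exists K, d'; split => //; last by rewrite sumK.
by apply: fintype.subset_trans sK _; rewrite subD1set.
Qed.

End dependence.

(** * Bounds on multipliers by the norm of their combination *)

Section uniform_bound.
Variables (R : realType) (m p : nat).
Local Notation T := (option 'I_p).
Implicit Types (G : T -> 'rV[R]_m) (K S : {set T}).

(** By compactness: the norm of the combination attains its minimum over coefficients that are
    nonnegative on [K] and have l^1 norm 1 on [K :|: S]; a zero minimum would be a positive-linear
    dependence. Homogeneity does the rest. *)
Lemma positive_independent_bound G K S :
  (forall i, i \in K -> i \notin S) -> ~ posLinDep G K S ->
  exists2 c : R, 0 < c & forall a : T -> R, (forall i, i \in K -> 0 <= a i) ->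
    c * \sum_(i in K :|: S) `|a i| <= `|\sum_(i in K :|: S) a i *: G i|.
Proof.
move=> dKS ind; have disKS : fintype.disjoint (mem K) (mem S).
  by rewrite disjoint_subset; apply/fintype.subsetP => i /dKS.
pose N := #|{: T}|.
pose co (v : 'rV[R]_N) i := v 0 (enum_rank i).
have cco i : continuous (fun v => co v i) by exact: coord_continuous.
pose nrm (v : 'rV[R]_N) := \sum_(i in K :|: S) `|co v i|.
have cnrm : continuous nrm.
  apply: (continuous_big (@add_continuous R)) => i _ v.
  exact: (continuous_comp (cco i v) (@norm_continuous _ _ _)).
(* The box gives compactness; it also confines the coordinates outside [K :|: S], which the other
   two conditions leave free. *)
pose B := [set v : 'rV[R]_N | forall i, `[-1, 1]%classic (v ord0 i)] `&`
  ((\bigcap_(i in [set i | i \in K]) [set v | 0 <= co v i]) `&`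
   (nrm @^-1` [set 1])).
have cB : compact B.
  apply: compact_closedI.
    exact: (@rV_compact R N (fun=> `[-1, 1]%classic)
      (fun=> @segment_compact R (-1) 1)).
  apply: closedI.
    apply: closed_bigI => i _.
    apply: (preimage_closed (f := fun v => co v i) (D := [set x | 0 <= x])).
      by move=> v _; exact: cco.
    exact: closed_ge.
  apply: preimage_closed; first by move=> v _; exact: cnrm.
  exact: closed_eq.
pose comb (v : 'rV[R]_N) := \sum_(i in K :|: S) co v i *: G i.
have ccomb : continuous (fun v => `|comb v|).
  suff cc : continuous comb.
    by move=> v; exact: (continuous_comp (cc v) (@norm_continuous _ _ _)).
  apply: (continuous_big (@add_continuous _)) => i _ v.
  exact: (cvgZ (cco i v) (cvg_cst _)).
have normalize (a : T -> R) : (forall i, i \in K -> 0 <= a i) ->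
    0 < \sum_(i in K :|: S) `|a i| -> exists2 v, B v &
    \sum_(i in K :|: S) a i *: G i = (\sum_(i in K :|: S) `|a i|) *: comb v.
  move=> a0; set s := \sum_(i in _) _ => s0.
  pose b i := if i \in K :|: S then a i / s else 0.
  pose v : 'rV[R]_N := \row_j b (enum_val j).
  have cov i : co v i = b i by rewrite /co mxE enum_rankK.
  exists v; last first.
    rewrite scaler_sumr; apply: eq_bigr => i iKS.
    by rewrite cov /b iKS scalerA mulrC divfK // gt_eqF.
  split=> [j /=|].
    rewrite in_itv /= -ler_norml mxE /b; case: ifPn => [iKS|_]; last by rewrite normr0.
    rewrite normrM normfV (gtr0_norm s0) ler_pdivrMr // mul1r /s.
    by rewrite (bigD1 _ iKS) /= lerDl sumr_ge0.
  split=> [i /= iK|].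
    by rewrite cov /b inE iK /= divr_ge0 ?a0 // ltW.
  rewrite /= /nrm; under eq_bigr => i iKS.
    rewrite cov /b iKS normrM normfV (gtr0_norm s0); over.
  by rewrite -mulr_suml divff // gt_eqF.
have [Bn|B0] := pselect (B !=set0); last first.
  exists 1 => // a a0; rewrite mul1r.
  have [s0|s0] := ltP 0 (\sum_(i in K :|: S) `|a i|).
    by case: B0; have [v Bv _] := normalize a a0 s0; exists v.
  exact: le_trans s0 (normr_ge0 _).
have [v0 Bv0 vmin] := compact_EVT_min Bn cB (continuous_subspaceT ccomb).
have c0 : 0 < `|comb v0|.
  rewrite normr_gt0; apply/eqP => comb0; apply: ind.
  move: Bv0; rewrite inE => -[_ [posv nrmv]].
  exists (co v0), (co v0); split; first by move=> i iK; exact: posv.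
  split; last first.
    apply: etrans comb0; rewrite /comb -bigU //.
    by apply: eq_bigl => i; rewrite !inE.
  apply: contrapT => no; move/eqP: nrmv.
  rewrite /nrm big1 ?(eq_sym 0) ?oner_eq0 // => i iKS.
  apply/eqP; rewrite normr_eq0; apply/negPn/negP => ci; apply: no.
  by exists i; move: iKS; rewrite inE => /orP[iK|iS]; [left|right].
exists `|comb v0| => // a a0.
have [s0|s0] := ltP 0 (\sum_(i in K :|: S) `|a i|); last first.
  by apply: le_trans (normr_ge0 _); rewrite mulr_ge0_le0.
have [v Bv ->] := normalize a a0 s0.
rewrite normrZ (gtr0_norm s0) mulrC ler_wpM2l ?(ltW s0) //.
by apply: vmin; rewrite inE.
Qed.

(** Half of the constant at [zb] survives: moving each vector by less than [c / 2] changes the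
    combination by at most [c / 2] times the l^1 norm of the coefficients, so one neighborhood
    serves all [a]. *)
Lemma near_positive_independent_bound (Z : topologicalType)
    (G : Z -> T -> 'rV[R]_m) (zb : Z) K S :
  (forall i, {for zb, continuous (fun z => G z i)}) ->
  (forall i, i \in K -> i \notin S) -> ~ posLinDep (G zb) K S ->
  exists2 c : R, 0 < c & \forall z \near zb,
    forall a : T -> R, (forall i, i \in K -> 0 <= a i) ->
    c * \sum_(i in K :|: S) `|a i| <= `|\sum_(i in K :|: S) a i *: G z i|.
Proof.
move=> cG dKS ind; have [c c0 cP] := positive_independent_bound dKS ind.
have c20 : 0 < c / 2 by rewrite divr_gt0.
exists (c / 2) => //.
have : \forall z \near zb, forall i, `|G zb i - G z i| < c / 2.
  by apply: filter_forall => i; exact: (@cvgr_dist_lt _ _ _ _ _ _ _ (cG i)).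
apply: filterS => z near_z a a0.
have := cP a a0; set s := \sum_(i in _) _.
have -> : \sum_(i in K :|: S) a i *: G zb i =
    \sum_(i in K :|: S) a i *: G z i +
    \sum_(i in K :|: S) a i *: (G zb i - G z i).
  by rewrite -big_split /=; apply: eq_bigr => i _; rewrite scalerBr subrKC.
move=> /le_trans/(_ (ler_normD _ _)) le1.
have le2 : `|\sum_(i in K :|: S) a i *: (G zb i - G z i)| <= c / 2 * s.
  apply: le_trans (ler_norm_sum _ _ _) _; rewrite mulr_sumr.
  apply: ler_sum => i _; rewrite normrZ mulrC ler_wpM2r // ltW //.
rewrite -(lerD2r (c / 2 * s)) -mulrDl -splitr.
by apply: le_trans le1 _; rewrite lerD2l.
Qed.

End uniform_bound.

(** * Partial gradients of convex and affine functions *)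

Section partial_gradient.
Variables (R : realType) (n m : nat).
Implicit Types (g : 'rV[R]_n * 'rV[R]_m -> R) (x : 'rV[R]_n) (y : 'rV[R]_m).

Lemma derive_grad_y g z (v : 'rV[R]_m) :
  differentiable g z -> 'D_(0, v) g z = dot (grad_y g z) v.
Proof.
move=> dg; rewrite deriveE //.
have -> : ((0, v) : 'rV[R]_n * 'rV[R]_m) =
    \sum_(j < m) v 0 j *: ((0, delta_mx 0 j) : 'rV[R]_n * 'rV[R]_m).
  rewrite {1}[v]row_sum_delta.
  elim/big_rec2: _ => [//|j u w _ <-].
  by congr (_, _) => /=; rewrite ?scaler0 ?addr0.
rewrite linear_sum /dot; apply: eq_bigr => j _.
by rewrite linearZ /= mxE deriveE // mulrC.
Qed.

Lemma grad_y_cvg g x y v : differentiable g (x, y) ->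
  (t^-1 * (g (x, y + t *: v) - g (x, y))) @[t --> 0^'+] -->
  dot (grad_y g (x, y)) v.
Proof.
move=> dg; rewrite -derive_grad_y //.
have := cvg_dnbhs_at_right (@diff_derivable _ _ _ g (x, y) (0, v) dg).
rewrite -/(derive g (x, y) (0, v)).
apply: cvg_trans; apply: near_eq_cvg; near=> t => /=.
congr (_ * (g _ - _)); congr (_, _) => /=.
  by rewrite scaler0 add0r.
by rewrite addrC.
Unshelve. all: by end_near. Qed.

Let segment y1 y2 (t : R) : y1 + t *: (y2 - y1) = t *: y2 + (1 - t) *: y1.
Proof. by rewrite scalerBl scale1r scalerBr addrCA addrA. Qed.

(** Convexity bounds the difference quotient at small positive [t] by the increment over the whole
    segment; the bound passes to the limit. *)
Lemma convex_grad_y_le g x y1 y2 : convex_in_y g -> differentiable g (x, y1) ->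
  dot (grad_y g (x, y1)) (y2 - y1) <= g (x, y2) - g (x, y1).
Proof.
move=> cg dg; apply: cvgr_to_le (grad_y_cvg (v := y2 - y1) dg) _.
near=> t; have t0 : 0 < t by near: t; exact: nbhs_right_gt.
rewrite segment mulrC ler_pdivrMr //.
have : 0 <= t <= 1 by rewrite ltW //=; near: t; exact: nbhs_right_le.
by move=> /(cg x y2 y1); lra.
Unshelve. all: by end_near. Qed.

Lemma affine_grad_y g x y1 y2 : affine_in_y g -> differentiable g (x, y1) ->
  dot (grad_y g (x, y1)) (y2 - y1) = g (x, y2) - g (x, y1).
Proof.
move=> cg dg; apply/eqP; rewrite eq_le; apply/andP.
have qE : \forall t \near 0^'+, g (x, y2) - g (x, y1) =
    t^-1 * (g (x, y1 + t *: (y2 - y1)) - g (x, y1)).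
  near=> t; have t0 : 0 < t by near: t; exact: nbhs_right_gt.
  by rewrite segment cg; field; rewrite gt_eqF.
split; [apply: cvgr_to_le (grad_y_cvg dg) _|apply: cvgr_to_ge (grad_y_cvg dg) _];
  by apply: filterS qE => t ->.
Unshelve. all: by end_near. Qed.

End partial_gradient.

(* The amount by which the value [a] violates an equality ([e = true], signed)
   or a [<= 0] constraint. *)
Definition violation (R : realType) (e : bool) (a : R) : R :=
  if e then a else Num.max a 0.

(** * Squared violations and their first-order condition *)

Section violation_theory.
Variable R : realType.
Implicit Types (e : bool) (a b : R).

Lemma violation_mul e a : violation e a * a = violation e a ^+ 2.
Proof.
by rewrite /violation; case: e => //; case: (leP a 0); rewrite expr2 ?mul0r.
Qed.

(** The squared violation is C^1 with derivative [2 * violation e a], Lipschitz with constant 2,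
    whence the remainder [b ^+ 2]. Only this upper bound is used below, in place of a derivative. *)
Lemma violation_sqrD e a b :
  violation e (a + b) ^+ 2 <= violation e a ^+ 2 + 2 * violation e a * b + b ^+ 2.
Proof.
rewrite /violation; case: e; first by nra.
by have [?|?] := leP a 0; have [?|?] := leP (a + b) 0; nra.
Qed.

Lemma violation_continuous e : continuous (@violation R e).
Proof.
move=> a; rewrite /violation; case: e; first exact: cvg_id.
exact: (@continuous_max _ _ _ _ _ (@cvg_id _ _) (cvg_cst _)).
Qed.

(** After [violation_sqrD] and division by [t], minimality makes [\sum_i (2 * lam i * q i t + t * (q
    i t * q i t))] nonnegative for small [t]; its limit is twice the sum in the conclusion. *)
Lemma sum_violation_first_order (T : finType) (eq_cstr : T -> bool)
    (u : T -> R -> R) (D : T -> R) :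
  (forall i, (t^-1 * (u i t - u i 0)) @[t --> 0^'+] --> D i) ->
  (\forall t \near 0^'+, \sum_i violation (eq_cstr i) (u i 0) ^+ 2 <=
                        \sum_i violation (eq_cstr i) (u i t) ^+ 2) ->
  0 <= \sum_i violation (eq_cstr i) (u i 0) * D i.
Proof.
move=> uD umin; pose lam i := violation (eq_cstr i) (u i 0).
pose q i t := t^-1 * (u i t - u i 0).
have lim : (\sum_i (2 * lam i * q i t + t * (q i t * q i t))) @[t --> 0^'+] -->
    \sum_i (2 * lam i * D i + 0 * (D i * D i)).
  apply: (cvg_big (@add_continuous _)) => i _.
  apply: cvgD; first by apply: cvgM; [exact: cvg_cst|exact: uD].
  apply: cvgM; last by apply: cvgM; exact: uD.
  exact: (cvg_at_right_filter cvg_id).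
suff : 0 <= \sum_i (2 * lam i * D i + 0 * (D i * D i)).
  under eq_bigr do rewrite mul0r addr0 -mulrA.
  by rewrite -mulr_sumr pmulr_rge0.
apply: cvgr_to_ge lim _; near=> t.
have t0 : 0 < t by near: t; exact: nbhs_right_gt.
rewrite -(pmulr_rge0 _ t0) mulr_sumr.
have : \sum_i lam i ^+ 2 <= \sum_i violation (eq_cstr i) (u i t) ^+ 2 by near: t.
rewrite -subr_ge0 -sumrB => /le_trans; apply; apply: ler_sum => i _.
have := violation_sqrD (eq_cstr i) (u i 0) (u i t - u i 0).
rewrite subrKC -/(lam i).
have -> : u i t - u i 0 = t * q i t by rewrite /q mulVKf // gt_eqF.
by move: (lam i) (q i t) (violation _ _) => a b c; nra.
Unshelve. all: by end_near. Qed.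

End violation_theory.

(** * Exact feasibility in a ball from small violations at its center *)

Section feasibility.
Variables (R : realType) (m p : nat).
Local Notation T := (option 'I_p).
(** In the application a parameter [x] is fixed: [g] collects the [h i (x, _)] and, at [None],
    [f (x, _)] minus its optimal value, while [s] is any solution for [x]. *)
Variables (g : T -> 'rV[R]_m -> R) (G : 'rV[R]_m -> T -> 'rV[R]_m).
Variables (J S : {set T}) (s yb : 'rV[R]_m) (r c delta : R).

Hypothesis g_continuous : forall i, continuous (g i).
Hypothesis g_derive : forall i y v,
  (t^-1 * (g i (y + t *: v) - g i y)) @[t --> 0^'+] --> dot (G y i) v.
Hypothesis g_convex : forall i y1 y2,
  dot (G y1 i) (y2 - y1) <= g i y2 - g i y1.
Hypothesis g_affine : forall i y1 y2, i \in J ->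
  dot (G y1 i) (y2 - y1) = g i y2 - g i y1.
Hypothesis feasible_le : forall i, i \notin J -> g i s <= 0.
Hypothesis feasible_eq : forall i, i \in J -> g i s = 0.
Hypothesis center_le : forall i, i \notin J -> g i yb <= delta.
Hypothesis center_eq : forall i, i \in J -> `|g i yb| <= delta.
Hypothesis subSJ : S \subset J.
Hypothesis free_S : forall y, `|y - yb| <= r -> ~ linDep (G y) S.
Hypothesis span_S : forall y j, `|y - yb| <= r -> j \in J ->
  exists e : T -> R, G y j = \sum_(i in S) e i *: G y i.
(** Asked only for inequalities violated at [y]: near the reference point these are active there or
    carry the index [None], the range of [K] that RCPLD covers. *)
Hypothesis bound : forall y (K : {set T}) (a : T -> R), `|y - yb| <= r ->
  (forall i, i \in K -> i \notin J /\ 0 < g i y) ->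
  ~ linDep (G y) (K :|: S) -> (forall i, i \in K -> 0 <= a i) ->
  c * \sum_(i in K :|: S) `|a i| <= `|\sum_(i in K :|: S) a i *: G y i|.

Local Notation N := (#|{: T}|%:R : R).
Hypotheses (r0 : 0 <= r) (c0 : 0 < c) (delta0 : 0 <= delta).
Hypothesis small : (N + 1) * delta < r * c.

Let lam y i := violation (i \in J) (g i y).
Let P y := \sum_i lam y i ^+ 2.

Let P_continuous : continuous P.
Proof.
apply: (continuous_big (@add_continuous R)) => i _ y.
have cl : lam ^~ i z @[z --> y] --> lam y i.
  exact: (continuous_comp (@g_continuous i y) (@violation_continuous _ _ _)).
exact: (continuous_comp cl (@exprn_continuous R 2 _)).
Qed.

Let ball_min : exists2 y', `|y' - yb| <= r &
  forall y, `|y - yb| <= r -> P y' <= P y.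
Proof.
pose B := [set y : 'rV[R]_m | `|y - yb| <= r].
have cB : compact B.
  apply: bounded_closed_compact.
    exists (r + `|yb|); split; first exact: num_real.
    move=> M ltM y By; apply: le_trans (ltW ltM).
    by rewrite -[y](subrK yb); apply: le_trans (ler_normD _ _) _; rewrite lerD2r.
  pose f (y : 'rV[R]_m) : R := `|y - yb|.
  have cf : continuous f.
    by move=> y; exact: (cvg_norm (cvgB cvg_id (cvg_cst _))).
  rewrite (_ : B = f @^-1` [set x | x <= r]) //.
  by apply: preimage_closed; [move=> y _; exact: cf|exact: closed_le].
have B0 : B !=set0 by exists yb; rewrite /B /= subrr normr0.
have [y' By' miny'] := compact_EVT_min B0 cB (continuous_subspaceT P_continuous).
exists y'; first by rewrite inE in By'.
by move=> y By; apply: miny'; rewrite inE.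
Qed.

(* If the minimizer [y'] of the penalty [P] over the ball is infeasible, the
   penalty gradient [- w] at [y'] does not vanish, so [w] reaches the boundary
   of the ball: [r * `|w| <= dot w (y' - yb)]. A representation of [w] with
   multipliers of size at most [`|w| / c] makes the right-hand side
   [O(delta * `|w| / c)]. *)
Lemma feasible_in_ball : exists2 y, `|y - yb| <= r &
  (forall i, i \notin J -> g i y <= 0) /\ (forall i, i \in J -> g i y = 0).
Proof.
have [y' By' miny'] := ball_min.
have P_ge0 : 0 <= P y' by apply: sumr_ge0 => i _; exact: sqr_ge0.
move: P_ge0; rewrite le_eqVlt => /orP[/eqP/esym P0|Pgt0].
  have lam0 i : lam y' i = 0.
    by apply/eqP; rewrite -sqrf_eq0; apply/eqP; apply: (psumr_eq0P _ P0) => // j _; exact: sqr_ge0.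
  exists y' => //; split=> i iJ; have := lam0 i; rewrite /lam /violation.
    by rewrite (negbTE iJ) => max0; rewrite -max0 le_max lexx.
  by rewrite iJ.
exfalso.
have lam_ge0 i : i \notin J -> 0 <= lam y' i.
  by move=> iJ; rewrite /lam /violation (negbTE iJ) le_max lexx orbT.
pose w := - \sum_i lam y' i *: G y' i.
have dotw v : dot w v = - \sum_i lam y' i * dot (G y' i) v.
  by rewrite /w dotNl dot_suml.
(* The segment from [y'] to [y] stays in the ball, so [P] has a one-sided minimum at [t = 0]; thus
   [w] is normal to the ball at [y']. *)
have first_order y : `|y - yb| <= r -> dot w (y - y') <= 0.
  move=> By; rewrite dotw oppr_le0.
  pose u i t := g i (y' + t *: (y - y')).
  have u0 i : u i 0 = g i y' by rewrite /u scale0r addr0.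
  suff : 0 <= \sum_i violation (i \in J) (u i 0) * dot (G y' i) (y - y').
    by under eq_bigr do rewrite u0.
  apply: sum_violation_first_order => [i|]; first by rewrite u0; exact: g_derive.
  near=> t; under eq_bigr do rewrite u0.
  apply: miny'.
  have t0 : 0 < t by near: t; exact: nbhs_right_gt.
  have t1 : t <= 1 by near: t; exact: nbhs_right_le.
  have -> : y' + t *: (y - y') - yb = (1 - t) *: (y' - yb) + t *: (y - yb).
    by apply/rowP => j; rewrite !mxE; ring.
  apply: le_trans (ler_normD _ _) _; rewrite !normrZ (gtr0_norm t0).
  rewrite ger0_norm ?subr_ge0 //.
  have -> : r = (1 - t) * r + t * r by ring.
  by rewrite lerD // ler_wpM2l ?subr_ge0 // ltW.
(* If [w] were zero, testing against the feasible point [s] would give [0 <= - P y'] by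
   convexity. *)
have w0 : 0 < `|w|.
  rewrite normr_gt0; apply/eqP => w0.
  have : dot w (s - y') = 0 by rewrite w0 /dot big1 // => j _; rewrite mxE mul0r.
  rewrite dotw => /eqP; rewrite oppr_eq0 => /eqP sum0.
  suff : \sum_i lam y' i * dot (G y' i) (s - y') <= - P y'.
    by rewrite sum0 oppr_ge0 leNgt Pgt0.
  rewrite -sumrN; apply: ler_sum => i _.
  rewrite /lam -violation_mul -mulrN -/(lam y' i).
  have [iJ|iJ] := boolP (i \in J); first by rewrite g_affine // feasible_eq // sub0r.
  apply: ler_wpM2l; first exact: lam_ge0.
  by apply: le_trans (g_convex _ _ _) _; rewrite lerBlDr addNr feasible_le.
pose A := [set i : T | (i \notin J) && (0 < g i y')]%SET.
have /choice[E spanE] : forall j, exists e : T -> R,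
    j \in J -> G y' j = \sum_(i in S) e i *: G y' i.
  move=> j.
  have [jJ|jJ] := boolP (j \in J); last by exists (fun=> 0).
  by have [e ->] := span_S By' jJ; exists e.
(* The multipliers of all equalities are moved onto [S] through the expansions [E]; violated
   inequalities keep theirs, which are nonnegative as the reduction requires. *)
pose a i := if i \in S then \sum_(j in J) lam y' j * E j i else lam y' i.
have notAS i : i \in A -> i \notin S.
  rewrite inE => /andP[iJ _]; apply: contra iJ; exact: (fintype.subsetP subSJ).
have aA i : i \in A -> a i = lam y' i by move=> /notAS/negbTE iS; rewrite /a iS.
have a_ge0 i : i \in A -> 0 <= a i.
  by move=> iA; rewrite aA // lam_ge0 //; move: iA; rewrite inE => /andP[].
have disAS : fintype.disjoint (mem A) (mem S).
  by rewrite disjoint_subset; apply/fintype.subsetP => i /notAS.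
have sumA : \sum_(i in A :|: S) a i *: G y' i = - w.
  have -> : \sum_(i in A :|: S) a i *: G y' i =
      \sum_(i in A) a i *: G y' i + \sum_(i in S) a i *: G y' i.
    by rewrite -bigU //; apply: eq_bigl => i; rewrite !inE.
  have -> : \sum_(i in S) a i *: G y' i = \sum_(j in J) lam y' j *: G y' j.
    under eq_bigr => i iS do rewrite /a iS scaler_suml.
    rewrite exchange_big; apply: eq_bigr => j jJ.
    rewrite [in RHS]spanE // scaler_sumr.
    by apply: eq_bigr => i _; rewrite scalerA.
  rewrite opprK [RHS](bigID (mem J)) /= [RHS]addrC; congr (_ + _).
  rewrite big_mkcond [RHS]big_mkcond; apply: eq_bigr => i _.
  have [iA|] := boolP (i \in A).
    by rewrite aA //; move: iA; rewrite inE => /andP[->].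
  rewrite inE negb_and -leNgt; case: (boolP (i \in J)) => //= iJ gi.
  by rewrite /lam /violation (negbTE iJ) max_r // scale0r.
have [K [d [sKA d0 freeK sumK]]] := conic_caratheodory (free_S By') a_ge0.
have dK : c * \sum_(i in K :|: S) `|d i| <= `|w|.
  rewrite -[leRHS]normrN -sumA -sumK; apply: bound => // i /(fintype.subsetP sKA).
  by rewrite inE => /andP[].
have [v vr vw] := dot_norming w r0.
have up1 : r * `|w| <= dot w (y' - yb).
  apply: le_trans vw _.
  have := @first_order (yb + v); rewrite addrC addKr => /(_ vr).
  have -> : yb + v - y' = v - (y' - yb) by apply/rowP => j; rewrite !mxE; ring.
  by rewrite dotBr subr_le0.
(* Each [g i yb - g i y'] is at most [(N + 1) * delta]: for an equality, even in absolute value, by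
   bounds [delta] and [N * delta] on the two terms; for an inequality in [K], because [g i y'] is
   positive. *)
have up2 : dot w (y' - yb) <= \sum_(i in K :|: S) `|d i| * ((N + 1) * delta).
  have -> : dot w (y' - yb) = \sum_(i in K :|: S) d i * dot (G y' i) (yb - y').
    have -> : w = - \sum_(i in K :|: S) d i *: G y' i by rewrite sumK sumA opprK.
    by rewrite dotNl dot_suml -mulN1r mulr_sumr; apply: eq_bigr => i _;
      rewrite -(opprB yb y') dotNr; ring.
  have N1 : 1 <= N by rewrite ler1n; apply/card_gt0P; exists None.
  (* Minimality gives [P y' <= P yb <= N * delta ^+ 2]; since [1 <= N], the root of [N] may be
     replaced by [N]. *)
  have g_le i : i \in J -> `|g i y'| <= N * delta.
    move=> iJ; rewrite -ler_sqr ?nnegrE ?mulr_ge0 //.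
    have le1 : `|g i y'| ^+ 2 <= P y'.
      rewrite /P (bigD1 i) //= {1}/lam /violation iJ -normrX ger0_norm ?sqr_ge0 //.
      by rewrite lerDl; apply: sumr_ge0 => j _; exact: sqr_ge0.
    have le2 : P y' <= N * delta ^+ 2.
      apply: le_trans (miny' yb _) _; first by rewrite subrr normr0.
      have -> : N * delta ^+ 2 = \sum_(j : T) delta ^+ 2.
        by rewrite sumr_const mulr_natl.
      apply: ler_sum => j _.
      rewrite -[leLHS]ger0_norm ?sqr_ge0 // normrX ler_sqr ?nnegrE //.
      rewrite /lam /violation; case: ifPn => jJ; first exact: center_eq.
      by rewrite ger0_norm ?le_max ?lexx ?orbT // ge_max delta0 center_le.
    apply: le_trans le1 (le_trans le2 _); rewrite exprMn ler_wpM2r ?sqr_ge0 //.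
    by rewrite expr2 ler_peMl // ?ler0n.
  apply: ler_sum => i; rewrite inE => iKS.
  have [iJ|iJ] := boolP (i \in J).
    rewrite g_affine //; apply: le_trans (ler_norm _) _; rewrite normrM ler_wpM2l //.
    apply: le_trans (ler_normB _ _) _; have := center_eq iJ; have := g_le i iJ; lra.
  have iK : i \in K.
    by case/orP: iKS => // /(fintype.subsetP subSJ) iJ'; rewrite iJ' in iJ.
  rewrite (ger0_norm (d0 i iK)); apply: ler_wpM2l; first exact: d0.
  have gi : 0 < g i y'.
    by move/(fintype.subsetP sKA): iK; rewrite inE => /andP[].
  apply: le_trans (g_convex _ _ _) _; have := center_le iJ.
  by have := mulr_ge0 (ler0n R #|{: T}|) delta0; lra.
have M0 : 0 <= (N + 1) * delta by rewrite mulr_ge0 // addr_ge0.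
move: up2; rewrite -mulr_suml; move: M0 dK up1 w0 small c0.
have : 0 <= \sum_(i in K :|: S) `|d i| by exact: sumr_ge0.
move: (\sum_(i in K :|: S) `|d i|) (`|w|) (dot w _) ((N + 1) * delta) => D W X M.
move=> D0 M0 cD rW W0 Mrc cc XDM.
(* The chain [r * W * c <= D * M * c <= W * M < W * (r * c)] is contradictory. *)
have : r * W * c <= D * M * c by rewrite ler_pM2r //; exact: le_trans rW XDM.
have : c * D * M <= W * M by exact: ler_wpM2r.
have : W * M < W * (r * c) by rewrite ltr_pM2l.
lra.
Unshelve. all: by end_near. Qed.

End feasibility.

(** * Persistence of the spanning property under constant rank *)

Section constant_rank.
Variables (R : realType) (n m p l : nat).
Local Notation pt := ('rV[R]_n * 'rV[R]_m)%type.
Local Notation T := (option 'I_p).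
Variables (f : pt -> R) (h : 'I_p -> pt -> R) (S : {set T}).
Hypothesis subSJ : S \subset Jset p l.

(** Rows outside the index set are zeroed rather than dropped, so this is the matrix of [rankJ] and
    [Smx] has the same size. *)
Let Jmx z : 'M[R]_(p, m) :=
  \matrix_(i < p) (if (l <= i)%N then grad_y (h i) z else 0).
Let Smx z : 'M[R]_(p, m) :=
  \matrix_(i < p) (if Some i \in S then grad_y (h i) z else 0).

Let S_None : None \notin S.
Proof. by apply/negP => /(fintype.subsetP subSJ); rewrite inE. Qed.

Let S_Some i : Some i \in S -> (l <= i)%N.
Proof. by move=> /(fintype.subsetP subSJ); rewrite inE. Qed.

Let mul_Smx z (u : 'rV[R]_p) (e : T -> R) : (forall i, e (Some i) = u 0 i) ->
  u *m Smx z = \sum_(i in S) e i *: gradfam f h z i.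
Proof.
move=> eu; rewrite mulmx_sum_row (reindex_omap Some id); last first.
  by case=> // NS; move: S_None; rewrite NS.
rewrite [RHS]big_mkcond; apply: eq_bigr => i _; rewrite rowK eqxx andbT eu.
by case: ifP => // _; rewrite scaler0.
Qed.

Let ker_Smx z (u : 'rV[R]_p) : ~ linDep (gradfam f h z) S ->
  (u <= kermx (Smx z))%MS = [forall i, (Some i \in S) ==> (u 0 i == 0)].
Proof.
move=> freeS; pose e (i : T) := if i is Some k then u 0 k else 0.
have eu i : e (Some i) = u 0 i by [].
apply/sub_kermxP/forallP => [uS i|u0].
  apply/implyP => iS; apply/negPn/negP => ui; apply: freeS; exists e.
  by rewrite -(mul_Smx z eu); split; [exists (Some i)|].
rewrite (mul_Smx z eu) big1 // => -[k|] kS.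
  by have /implyP/(_ kS)/eqP := u0 k => uk; rewrite eu uk scale0r.
by move: S_None; rewrite kS.
Qed.

(** For a free family the left kernel of [Smx z] consists of the vectors vanishing on [S], whatever
    [z] is; rank-nullity concludes. *)
Let rank_Smx z1 z2 : ~ linDep (gradfam f h z1) S ->
  ~ linDep (gradfam f h z2) S -> \rank (Smx z1) = \rank (Smx z2).
Proof.
move=> free1 free2.
have rk z : \rank (Smx z) = (p - \rank (kermx (Smx z)))%N.
  by rewrite mxrank_ker subKn // rank_leq_row.
rewrite !rk; congr (_ - _)%N; apply/eqP; rewrite eqn_leq; apply/andP; split;
  by apply: mxrankS; apply/rV_subP => u; rewrite !ker_Smx.
Qed.

(** The row space of [Smx z] lies in that of [Jmx z]. The rank of [Jmx z] is that of [Jmx zb], at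
    most that of [Smx zb], which is that of [Smx z]; so the row spaces coincide. *)
Lemma constant_rank_span zb z : basis_of_span (gradfam f h zb) S (Jset p l) ->
  ~ linDep (gradfam f h z) S -> rankJ h l z = rankJ h l zb ->
  forall j, j \in Jset p l ->
  exists e : T -> R, gradfam f h z j = \sum_(i in S) e i *: gradfam f h z i.
Proof.
move=> [_ [free_zb span_zb]] free_z rk.
pose e0 (u : 'rV[R]_p) (i : T) := if i is Some k then u 0 k else 0.
have Jzb : (Jmx zb <= Smx zb)%MS.
  apply/row_subP => i; rewrite rowK; case: ifP => li; last exact: sub0mx.
  have [|e ge] := span_zb (Some i); first by rewrite inE.
  rewrite [grad_y _ _]ge -(@mul_Smx zb (\row_k e (Some k)) e) ?submxMl //.
  by move=> k; rewrite mxE.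
have SJz : (Smx z <= Jmx z)%MS.
  apply/row_subP => i; rewrite rowK; case: ifP => [/S_Some li|_]; last exact: sub0mx.
  by have := row_sub i (Jmx z); rewrite rowK li.
have JSz : (Jmx z <= Smx z)%MS.
  rewrite -(mxrank_leqif_sup SJz) eqn_leq mxrankS //= [leqLHS]rk.
  by rewrite (rank_Smx free_z free_zb) mxrankS.
case=> [j|]; last by rewrite inE.
rewrite inE => lj; have := submx_trans (row_sub j _) JSz.
rewrite rowK lj => /submxP[u gu]; exists (e0 u).
by rewrite [LHS]gu; apply: mul_Smx.
Qed.

End constant_rank.

(** * Solvability of the lower level and semicontinuity of its value *)

Section value_function.
Variables (R : realType) (n m p l : nat).
Local Notation pt := ('rV[R]_n * 'rV[R]_m)%type.
Variables (f : pt -> R) (h : 'I_p -> pt -> R).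
Hypotheses (cf : continuous f) (ch : forall i, continuous (h i)).

Lemma slice_continuous (g : pt -> R) x : continuous g ->
  continuous (fun y => g (x, y)).
Proof.
move=> cg y.
have cp : (x, z) @[z --> y] --> (x, y).
  exact: (@cvg_pair _ _ _ _ (nbhs x) (nbhs y) _ _ _ _ _ (cvg_cst _) cvg_id).
exact: (cvg_comp _ _ cp (cg (x, y))).
Qed.

Lemma closed_slice (g : pt -> R) x (D : set R) : continuous g -> closed D ->
  closed [set y | D (g (x, y))].
Proof.
move=> cg cD; rewrite (_ : mkset _ = (fun y => g (x, y)) @^-1` D) //.
by apply: preimage_closed => // y _; exact: slice_continuous.
Qed.

Lemma Sol_nonempty x : domGamma h l x -> locally_bounded (Gamma h l) x ->
  exists s, Sol f h l x s.
Proof.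
move=> [y0 y0G] [B [V [[M BM] [nV VB]]]].
have cG : compact (Gamma h l x).
  apply: bounded_closed_compact.
    exists M; split; first exact: num_real.
    move=> N ltN y Gy; apply: le_trans (ltW ltN).
    by apply: BM; apply: VB Gy; exact: nbhs_singleton.
  have -> : Gamma h l x =
      (\bigcap_(i in [set i : 'I_p | (i < l)%N]) [set y | h i (x, y) <= 0]) `&`
      (\bigcap_(i in [set i : 'I_p | (l <= i)%N]) [set y | h i (x, y) = 0]).
    by apply/seteqP; split.
  apply: closedI; apply: closed_bigI => i _.
    exact: (closed_slice (D := [set a | a <= 0]) (@ch i) (@closed_le _ _)).
  exact: (closed_slice (D := [set a | a = 0]) (@ch i) (@closed_eq _ _)).
have [s sG smin] := compact_EVT_min (ex_intro _ y0 y0G) cG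
  (continuous_subspaceT (slice_continuous (x := x) cf)).
exists s; split; first by rewrite inE in sG.
by move=> y yG; apply: smin; rewrite inE.
Qed.

(** Lower semicontinuity of the value function, phrased without an infimum. Feasible sets near [xb]
    lie in one compact ball; near each of its points either [f] stays above [v] or a violated
    constraint stays violated. *)
Lemma near_value_gt xb (v : R) : locally_bounded (Gamma h l) xb ->
  (forall y, Gamma h l xb y -> v < f (xb, y)) ->
  \forall x \near xb, forall y, Gamma h l x y -> v < f (x, y).
Proof.
move=> [B [V [[M BM] [nV VB]]]] vf.
pose K := [set y : 'rV[R]_m | `|y| <= M].
have cK : compact K.
  apply: bounded_closed_compact.
    by exists M; split; [exact: num_real|move=> N ltN y /le_trans; apply; exact: ltW].
  rewrite (_ : K = (@Num.norm _ _) @^-1` [set x | x <= M]) //.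
  by apply: preimage_closed; [move=> y _; exact: norm_continuous|exact: closed_le].
have swap (g : pt -> R) y : continuous g ->
    g (q.2, q.1) @[q --> (y, xb)] --> g (xb, y).
  move=> cg; have cp : (q.2, q.1) @[q --> (y, xb)] --> (xb, y).
    exact: (@cvg_pair _ _ _ _ (nbhs xb) (nbhs y) _ _ _ _ _ cvg_snd cvg_fst).
  exact: (cvg_comp _ _ cp (cg (xb, y))).
have : \forall x \near xb, K `<=` (fun y => Gamma h l x y -> v < f (x, y)).
  apply: (proj1 (compact_near_coveringP K) cK _ (nbhs xb)
    (fun x y => Gamma h l x y -> v < f (x, y))) => y _.
  have [yG|] := pselect (Gamma h l xb y).
    have : \forall q \near (y, xb), v < f (q.2, q.1).
      by apply: (cvgr_gt _ (swap f y cf)); exact: vf.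
    by apply: filterS => -[y' x] /= + _.
  move=> /not_andP[|] /existsNP[i /not_implyP[il hi]].
    have : \forall q \near (y, xb), 0 < h i (q.2, q.1).
      by apply: (cvgr_gt _ (swap _ y (@ch i))); rewrite ltNge; exact/negP.
    by apply: filterS => -[y' x] /= hq [/(_ i il)]; rewrite leNgt hq.
  have : \forall q \near (y, xb), h i (q.2, q.1) != 0.
    by apply: (cvgr_neq0 _ (swap _ y (@ch i))); exact/eqP.
  by apply: filterS => -[y' x] /= hq [_ /(_ i il)]/eqP; rewrite (negbTE hq).
apply: filterS2 nV => x Vx KP y yG.
by apply: KP => //; apply: BM; exact: VB yG.
Qed.

End value_function.

(** * Inner semicontinuity of the solution map *)

Section inner_semicontinuity.
Variables (R : realType) (n m p l : nat).
Local Notation pt := ('rV[R]_n * 'rV[R]_m)%type.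
Local Notation T := (option 'I_p).
Variables (f : pt -> R) (h : 'I_p -> pt -> R).
Hypotheses (C1f : C1 f) (C1h : forall i, C1 (h i)).

Lemma C1_continuous (g : pt -> R) : C1 g -> continuous g.
Proof. by move=> [dg _] z; exact: differentiable_continuous. Qed.

Lemma grad_y_continuous (g : pt -> R) : C1 g -> continuous (grad_y g).
Proof.
move=> [_ cg]; have -> : grad_y g = fun z =>
    \sum_(j < m) 'D_(0, delta_mx 0 j) g z *: (delta_mx 0 j : 'rV[R]_m).
  apply/funext => z; rewrite [LHS]row_sum_delta; apply: eq_bigr => j _.
  by rewrite mxE.
apply: (continuous_big (@add_continuous _)) => j _ z.
exact: (cvgZ (cg _ z) (cvg_cst _)).
Qed.

Lemma gradfam_continuous i : continuous (fun z => gradfam f h z i).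
Proof. by case: i => [i|]; exact: grad_y_continuous. Qed.

(** Supplies the hypotheses of [feasible_in_ball]. Either [K] and [S] are positive-linearly
    independent at the base point and the perturbed bound applies, or RCPLD makes [K :|: S]
    dependent at [z], contrary to the freeness assumed. [Omega xb] allows ranks to be compared with
    the base point. *)
Lemma RCPLD_S_uniform (Omega : set 'rV[R]_n) xb yb :
  Omega xb -> RCPLD_S f h l Omega xb yb ->
  exists (S : {set T}) (c : R), [/\ S \subset Jset p l, 0 < c &
    \forall z \near (xb, yb), Omega z.1 ->
    [/\ ~ linDep (gradfam f h z) S,
        forall j, j \in Jset p l -> exists e : T -> R,
          gradfam f h z j = \sum_(i in S) e i *: gradfam f h z i &
        forall (K : {set T}) (a : T -> R),
          K \subset (None |: Iact h l (xb, yb))%SET ->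
          ~ linDep (gradfam f h z) (K :|: S) -> (forall i, i \in K -> 0 <= a i) ->
          c * \sum_(i in K :|: S) `|a i| <=
          `|\sum_(i in K :|: S) a i *: gradfam f h z i|]].
Proof.
move=> Oxb [U [S [nU [sSJ [basisS [rankU depU]]]]]].
pose act := (None |: Iact h l (xb, yb))%SET.
have disKS (K : {set T}) : K \subset act -> forall i, i \in K -> i \notin S.
  move=> sKact i /(fintype.subsetP sKact); rewrite !inE => iact.
  apply/negP => /(fintype.subsetP sSJ); rewrite inE.
  case: i iact => //= i /andP[il _].
  by rewrite leqNgt il.
pose good c (K : {set T}) z := K \subset act ->
  ~ posLinDep (gradfam f h (xb, yb)) K S ->
  forall a : T -> R, (forall i, i \in K -> 0 <= a i) ->
  c * \sum_(i in K :|: S) `|a i| <=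
  `|\sum_(i in K :|: S) a i *: gradfam f h z i|.
have /choice[cK cKP] : forall K : {set T}, exists c : R, 0 < c /\
    \forall z \near (xb, yb), good c K z.
  move=> K.
  have [[sK dK]|no] := pselect (K \subset act /\
      ~ posLinDep (gradfam f h (xb, yb)) K S); last first.
    exists 1; split => //; near=> z => sK dK; case: no; split => //.
  have [c c0 cP] := near_positive_independent_bound
    (fun i => @gradfam_continuous i (xb, yb)) (disKS K sK) dK.
  by exists c; split => //; apply: filterS cP => z cP _ _.
(* There are finitely many [K], so the minimum is positive. *)
pose c := \big[Order.min/1]_K cK K.
have c0 : 0 < c.
  by apply/bigmin_gtP; split => // K _; have [] := cKP K.
exists S, c; split => //.
have nearK : \forall z \near (xb, yb), forall K, good c K z.
  apply: (filter_forall (F := nbhs (xb, yb))) => K.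
  have [_] := cKP K.
  apply: filterS => z zP sK dK a a0; apply: le_trans (zP sK dK a a0).
  by rewrite ler_wpM2r ?sumr_ge0 // bigmin_le.
have Uzb := nbhs_singleton nU.
apply: filterS2 nearK nU => z nearK Uz Oz.
(* The bound for empty [K] forces the coefficients of any relation on [S] to vanish. *)
have freeS : ~ linDep (gradfam f h z) S.
  have nopos : ~ posLinDep (gradfam f h (xb, yb)) finset.set0 S.
    move=> [a [b [_ [[i [[i0 _]|[iS bi]]] sum0]]]].
      by rewrite finset.in_set0 in i0.
    case: basisS => _ [+ _]; apply; exists b; split; first by exists i.
    by move: sum0; rewrite big_set0 add0r.
  have s0 : finset.set0 \subset act by exact: finset.sub0set.
  have := nearK _ s0 nopos; rewrite finset.set0U => bnd [e [[i [iS ei]] sum0]].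
  have e0 (j : T) : j \in finset.set0 -> 0 <= e j by rewrite finset.in_set0.
  have := bnd e e0; rewrite sum0 normr0 leNgt => /negP; apply.
  rewrite mulr_gt0 //.
  by rewrite (bigD1 i) //= ltr_pwDl ?normr_gt0 // sumr_ge0.
split=> // [j jJ|K a sK freeK a0].
  apply: (constant_rank_span sSJ basisS freeS _ jJ).
  exact: rankU.
by apply: nearK => // /(depU K sK)/(_ z Uz Oz).
Unshelve. all: by end_near. Qed.

Hypothesis convex_f : convex_in_y f.
Hypothesis convex_h : forall i : 'I_p, (i < l)%N -> convex_in_y (h i).
Hypothesis affine_h : forall i : 'I_p, (l <= i)%N -> affine_in_y (h i).

(** The solution set at [x] is cut out by the constraints of [Gamma h l x] and
    [f (x, _) <= f (x, s)], a convex system to which [feasible_in_ball] applies around [yb]. *)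
Lemma Sol_inner_semicontinuous (X : set 'rV[R]_n) xb yb (r : R) :
  X `<=` domGamma h l -> (forall x, X x -> locally_bounded (Gamma h l) x) ->
  X xb -> Sol f h l xb yb -> RCPLD_S f h l (domGamma h l) xb yb -> 0 < r ->
  \forall x \near xb, X x -> exists2 y, Sol f h l x y & `|y - yb| <= r.
Proof.
move=> Xdom lb Xxb [yG ymin] rcpld r0.
have cf := C1_continuous C1f; have ch i := C1_continuous (C1h i).
have [S [c [sSJ c0 nearS]]] := RCPLD_S_uniform (Xdom _ Xxb) rcpld.
(* Constraints negative at [(xb, yb)] stay negative nearby, so an inequality violated nearby is
   active at the base point. *)
have nearI : \forall z \near (xb, yb), forall j : 'I_p,
    h j (xb, yb) < 0 -> h j z < 0.
  apply: (filter_forall (F := nbhs (xb, yb))) => j; have [hj|hj] := ltP (h j (xb, yb)) 0.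
    by apply: filterS (cvgr_lt _ (ch j (xb, yb)) _ hj) => z hz _.
  by near=> z.
have [e /= e0 eP] := proj1 (nbhs_ballP _ _) (filterI nearS nearI).
pose rho := Num.min r (e / 2).
have rho0 : 0 < rho by rewrite lt_min r0 divr_gt0.
have rho_e : rho < e.
  by apply: le_lt_trans (_ : e / 2 < e); rewrite ?ge_min ?lexx ?orbT //; lra.
pose N : R := #|{: T}|%:R.
have N0 : 0 < N + 1 by rewrite ltr_wpDl.
(* Makes [(N + 1) * delta] equal to half of [rho * c]. *)
pose delta := rho * c / (2 * (N + 1)).
have delta0 : 0 < delta by rewrite divr_gt0 ?mulr_gt0.
have small : (N + 1) * delta < rho * c.
  have -> : (N + 1) * delta = rho * c / 2.
    by rewrite /delta; field; rewrite gt_eqF.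
  by have := mulr_gt0 rho0 c0; lra.
have atyb (g : pt -> R) : continuous g -> g (x, yb) @[x --> xb] --> g (xb, yb).
  move=> cg; have cp : (x, yb) @[x --> xb] --> (xb, yb).
    exact: (@cvg_pair _ _ _ _ (nbhs xb) (nbhs yb) _ _ _ _ _ cvg_id (cvg_cst _)).
  exact: (cvg_comp _ _ cp (cg (xb, yb))).
have near_le : \forall x \near xb, forall j : 'I_p, (j < l)%N -> h j (x, yb) <= delta.
  apply: (filter_forall (F := nbhs xb)) => j; have [jl|jl] := boolP (j < l)%N; last by near=> x.
  have hj : h j (xb, yb) < delta by apply: le_lt_trans delta0; exact: yG.1.
  by apply: filterS (cvgr_lt _ (atyb _ (ch j)) _ hj) => x /ltW hx _.
have near_eq : \forall x \near xb, forall j : 'I_p, (l <= j)%N ->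
    `|h j (x, yb)| <= delta.
  apply: (filter_forall (F := nbhs xb)) => j; have [lj|lj] := boolP (l <= j)%N; last by near=> x.
  apply: filterS (@cvgr_dist_lt _ _ _ _ _ _ _ (atyb _ (ch j)) _ delta0) => x.
  by rewrite (yG.2 j lj) sub0r normrN => /ltW hx _.
(* Half of [delta] each: continuity bounds [f (x, yb)] above and semicontinuity of the value bounds
   [f (x, s)] below, so their difference stays below [delta]. *)
have near_f : \forall x \near xb, f (x, yb) < f (xb, yb) + delta / 2.
  by apply: (cvgr_lt _ (atyb _ cf)); rewrite ltrDl divr_gt0.
have near_phi : \forall x \near xb, forall y, Gamma h l x y ->
    f (xb, yb) - delta / 2 < f (x, y).
  apply: near_value_gt => // [|y /ymin]; first exact: lb.
  by apply: lt_le_trans; rewrite gtrBl divr_gt0.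
near=> x => Xx.
have [s [sG smin]] := Sol_nonempty cf ch (Xdom _ Xx) (lb _ Xx).
have xe : ball xb e x by near: x; exact: nbhsx_ballx.
have nearz y : `|y - yb| <= rho -> ball (xb, yb) e (x, y).
  move=> yr; split => //=; rewrite -ball_normE /ball_ /= distrC.
  exact: le_lt_trans yr rho_e.
have near_le_x : forall j : 'I_p, (j < l)%N -> h j (x, yb) <= delta by near: x.
have near_eq_x : forall j : 'I_p, (l <= j)%N -> `|h j (x, yb)| <= delta by near: x.
have near_f_x : f (x, yb) < f (xb, yb) + delta / 2 by near: x.
have near_phi_x : forall y, Gamma h l x y -> f (xb, yb) - delta / 2 < f (x, y).
  by near: x.
pose g (i : T) y := if i is Some j then h j (x, y) else f (x, y) - f (x, s).
have df : forall z, differentiable f z by exact: C1f.1.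
have dh j : forall z, differentiable (h j) z by exact: (C1h j).1.
have inJ (j : 'I_p) : (Some j \in Jset p l) = (l <= j)%N by rewrite inE.
have [] := @feasible_in_ball R m p g (fun y => gradfam f h (x, y)) (Jset p l) S
  s yb rho c delta.
- case=> [j|] y; first exact: (slice_continuous (ch j)).
  exact: (cvgB (@slice_continuous _ _ _ _ x cf y) (cvg_cst _)).
- case=> [j|] y v; first exact: grad_y_cvg.
  have -> : (fun t => t^-1 * (g None (y + t *: v) - g None y)) =
      fun t => t^-1 * (f (x, y + t *: v) - f (x, y)).
    by apply/funext => t; rewrite /g; congr (_ * _); ring.
  exact: grad_y_cvg.
- case=> [j|] y1 y2 /=; last by rewrite opprB addrA subrK; exact: convex_grad_y_le.
  have [jl|lj] := ltnP j l; first by apply: convex_grad_y_le => //; exact: convex_h.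
  by rewrite affine_grad_y //; exact: affine_h.
- case=> [j|] y1 y2; last by rewrite inE.
  by rewrite inJ => lj; apply: affine_grad_y => //; exact: affine_h.
- by case=> [j|]; rewrite ?inJ /= ?subrr // -ltnNge => /sG.1.
- by case=> [j|]; rewrite ?inJ ?inE //= => /sG.2.
- case=> [j|]; first by rewrite inJ -ltnNge => /near_le_x.
  by move=> _ /=; have := near_phi_x _ sG; lra.
- by case=> [j|]; rewrite ?inJ ?inE // => /near_eq_x.
- exact: sSJ.
- by move=> y /nearz/eP[/= /(_ (Xdom _ Xx))[]].
- by move=> y j /nearz/eP[/= /(_ (Xdom _ Xx))[_ + _] _]; exact.
- move=> y K a /nearz/eP[/= /(_ (Xdom _ Xx))[_ _ bnd] neg] Kpos freeK a0.
  apply: bnd => //; apply/fintype.subsetP => -[j|] jK; last by rewrite !inE.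
  have [] := Kpos _ jK; rewrite inJ -ltnNge => jl hj; rewrite !inE jl /=.
  rewrite eq_le yG.1 //= leNgt; apply/negP => /neg.
  by rewrite ltNge (ltW hj).
- exact: ltW.
- exact: c0.
- exact: ltW.
- exact: small.
move=> y yr [gle geq]; exists y; last first.
  by apply: le_trans yr _; rewrite ge_min lexx.
split.
  split=> j jl; first by apply: (gle (Some j)); rewrite inJ -ltnNge.
  by apply: (geq (Some j)); rewrite inJ.
move=> y' y'G; apply: le_trans (smin _ y'G).
by rewrite -subr_le0; apply: (gle None); rewrite inE.
Unshelve. all: by end_near. Qed.

End inner_semicontinuity.

(** * Existence of a minimizer *)

(** The sublevel sets [sub x] are nested, hence generate a proper filter. At a cluster point [xb], a
    smaller value [phi x] would by semicontinuity give a neighborhood missing [sub x]. *)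
Lemma lsc_compact_min (R : realType) (Z : topologicalType) (X : set Z)
    (phi : Z -> \bar R) : compact X -> X !=set0 ->
  (forall x v, X x -> (v < phi x)%E -> \forall y \near x, X y -> (v < phi y)%E) ->
  exists xb, X xb /\ forall x, X x -> (phi xb <= phi x)%E.
Proof.
move=> cX X0 lsc.
pose sub x := [set y | X y /\ (phi y <= phi x)%E].
pose F := filter_from X sub.
have FF : ProperFilter F.
  apply: filter_from_proper; last by move=> x Xx; exists x.
  apply: filter_from_filter => // x1 x2 X1 X2.
  have [le12|/ltW le21] := leP (phi x1) (phi x2).
    by exists x1 => // y [Xy y1]; split; split => //; exact: le_trans le12.
  by exists x2 => // y [Xy y2]; split; split => //; exact: le_trans le21.
have FX : F X by have [x Xx] := X0; exists x => // y [].
have [xb [Xxb clxb]] := cX F FF FX.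
exists xb; split => // x Xx; rewrite leNgt; apply/negP => ltx.
have Fsub : F (sub x) by exists x.
have [y [[Xy yx] /(_ Xy)]] := clxb _ _ Fsub (lsc _ _ Xxb ltx).
by rewrite ltNge yx.
Qed.

Unset Implicit Arguments.

Theorem theorem4p16 (R : realType) (n m p l : nat)
  (F f : 'rV[R]_n * 'rV[R]_m -> R) (h : 'I_p -> 'rV[R]_n * 'rV[R]_m -> R)
  (X : set 'rV[R]_n) :
  (l <= p)%N ->
  C1 F -> C1 f -> (forall i, C1 (h i)) ->
  closed X ->
  convex_in_y f ->
  (forall i : 'I_p, (i < l)%N -> convex_in_y (h i)) ->
  (forall i : 'I_p, (l <= i)%N -> affine_in_y (h i)) ->
  X `<=` domGamma h l ->
  (forall x, X x -> locally_bounded (Gamma h l) x) ->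
  (forall x y, X x -> Sol f h l x y -> RCPLD_S f h l (domGamma h l) x y) ->
  X !=set0 -> compact X ->
  exists xb, X xb /\ forall x, X x -> (phi_p F f h l xb <= phi_p F f h l x)%E.
Proof.
move=> _ C1F C1f C1h _ cvxf cvxh affh Xdom lb rcpld X0 cX.
have cF : continuous F := C1_continuous C1F.
apply: lsc_compact_min => // x v Xx vphi.
(* One solution [y] at [x] already has [F (x, y)] above [v]; a solution [y'] at [x'] close to it
   keeps the supremum at [x'] above [v]. *)
have [_ [y ySol <-] vF] := ereal_sup_gt vphi.
have nearF : \forall z \near (x, y), (v < (F z)%:E)%E.
  case: v vphi vF => [a| |] _ //= vF; last by near=> z; rewrite ltNyr.
  rewrite lte_fin in vF.
  by apply: filterS (cvgr_gt _ (cF (x, y)) _ vF) => z; rewrite lte_fin.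
have [e /= e0 eP] := proj1 (nbhs_ballP _ _) nearF.
have e20 : 0 < e / 2 by rewrite divr_gt0.
have := Sol_inner_semicontinuous C1f C1h cvxf cvxh affh Xdom lb Xx ySol
  (rcpld _ _ Xx ySol) e20.
apply: filterS2 (nbhsx_ballx x e e0) => x' xx' sol' /sol'[y' y'Sol yy'].
apply: (@lt_le_trans _ _ (F (x', y'))%:E); last first.
  by apply: ereal_sup_ubound; exists y'.
apply: eP; split => //=; rewrite -ball_normE /ball_ /= distrC.
by apply: le_lt_trans yy' _; lra.
Unshelve. all: by end_near. Qed.
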